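(* Let $\mathcal{S}=\langle\mathbf{Fm},\vdash\rangle$ be a logic over a language containing a binary connective $\longrightarrow$, in which the Deduction theorem holds: for all $\Sigma\cup\{\alpha,\beta\}\subseteq\mathit{Fm}$, $\Sigma\cup\{\alpha\}\vdash\beta$ implies $\Sigma\vdash\alpha\longrightarrow\beta$. Then the Deduction theorem holds in its left variable inclusion companion $\mathcal{S}^l=\langle\mathbf{Fm},\vdash^l\rangle$: for all $\Sigma\cup\{\alpha,\beta\}\subseteq\mathit{Fm}$, if $\Sigma\cup\{\alpha\}\vdash^l\beta$ then $\Sigma\vdash^l\alpha\longrightarrow\beta$.
   Context: $\mathbf{Fm}$ is the formula algebra of a logical language (connectives of finite arity) over a countably infinite set $V$ of variables, universe $\mathit{Fm}$. A logic is a pair $\langle\mathbf{Fm},\vdash\rangle$ with $\vdash\subseteq\mathcal{P}(\mathit{Fm})\times\mathit{Fm}$ reflexive, transitive (if $\Delta\vdash\psi$ for all $\psi\in\Sigma$ and $\Sigma\vdash\varphi$ then $\Delta\vdash\varphi$) and closed under substitutions. $\mathrm{var}(\varphi)$ is the set of variables of $\varphi$, $\mathrm{var}(\Gamma)=\bigcup_{\gamma\in\Gamma}\mathrm{var}(\gamma)$. Left variable inclusion companion: $\Gamma\vdash^l\varphi$ iff there is $\Gamma'\subseteq\Gamma$ with $\mathrm{var}(\Gamma')\subseteq\mathrm{var}(\varphi)$ and $\Gamma'\vdash\varphi$. *)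

(* Defs.v *)
From mathcomp Require Import all_boot.
From mathcomp Require Import boolp classical_sets functions cardinality.
Set Implicit Arguments.
Unset Strict Implicit.
Unset Printing Implicit Defensive.

Local Open Scope classical_set_scope.

Record language : Type := Language {
  connective : Type;
  arity : connective -> nat
}.

Inductive formula (L : language) (V : Type) : Type :=
| Var of V
| App (c : connective L) of {ffun 'I_(arity c) -> formula L V}.

Arguments Var {L V} _.
Arguments App {L V} c _.

Fixpoint var (L : language) (V : Type) (phi : formula L V) : set V :=
  match phi with
  | Var v => [set v]
  | App c args => \bigcup_(i in [set: 'I_(arity c)]) var (args i)
  end.

Definition vars (L : language) (V : Type) (Gamma : set (formula L V)) : set V :=
  \bigcup_(gamma in Gamma) var gamma.

(* Substitutions are the endomorphisms of the formula algebra. *)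
Definition substitution (L : language) (V : Type)
    (sigma : formula L V -> formula L V) : Prop :=
  forall (c : connective L) (args : {ffun 'I_(arity c) -> formula L V}),
    sigma (App c args) = App c [ffun i => sigma (args i)].

Record is_logic (L : language) (V : Type)
    (entails : set (formula L V) -> formula L V -> Prop) : Prop := IsLogic {
  logic_refl : forall (Gamma : set (formula L V)) (phi : formula L V),
    Gamma phi -> entails Gamma phi;
  logic_trans : forall (Delta Sigma : set (formula L V)) (phi : formula L V),
    (forall psi, Sigma psi -> entails Delta psi) ->
    entails Sigma phi -> entails Delta phi;
  logic_subst : forall (sigma : formula L V -> formula L V)
      (Gamma : set (formula L V)) (phi : formula L V),
    substitution sigma -> entails Gamma phi ->
    entails (sigma @` Gamma) (sigma phi)
}.

Definition left_companion (L : language) (V : Type)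
    (entails : set (formula L V) -> formula L V -> Prop)
    (Gamma : set (formula L V)) (phi : formula L V) : Prop :=
  exists Gamma' : set (formula L V),
    [/\ Gamma' `<=` Gamma, vars Gamma' `<=` var phi & entails Gamma' phi].

Definition binary_app (L : language) (V : Type) (c : connective L)
    (c2 : arity c = 2) (alpha beta : formula L V) : formula L V :=
  App c [ffun i => tnth [tuple alpha; beta] (cast_ord c2 i)].

Definition deduction_theorem (L : language) (V : Type)
    (entails : set (formula L V) -> formula L V -> Prop)
    (imp : connective L) (imp2 : arity imp = 2) : Prop :=
  forall (Sigma : set (formula L V)) (alpha beta : formula L V),
    entails (Sigma `|` [set alpha]) beta ->
    entails Sigma (binary_app imp2 alpha beta).

(* Main.v *)
Require Import Defs.
From mathcomp Require Import all_boot.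
From mathcomp Require Import boolp classical_sets functions cardinality.

Local Open Scope classical_set_scope.
Local Open Scope card_scope.

(** If [Gamma] witnesses that [beta] follows from [Sigma] and [alpha] in the companion, its part
    inside [Sigma] witnesses the implication. Only [alpha] can be lost, and the deduction theorem of
    the base logic discharges it. The variables stay admissible: they lie in [var beta], and [beta]
    is a subformula of the implication ([var_binary_app_right]). *)

Lemma entails_monotone (L : language) (V : Type)
    (entails : set (formula L V) -> formula L V -> Prop)
    (Gamma Delta : set (formula L V)) (phi : formula L V) :
  is_logic entails -> Gamma `<=` Delta -> entails Gamma phi ->
  entails Delta phi.
Proof.
move=> logicE sGD; apply: (logic_trans logicE) => psi /sGD.
exact: logic_refl.
Qed.

Lemma var_binary_app_right (L : language) (V : Type) (c : connective L)
    (c2 : arity c = 2) (alpha beta : formula L V) :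
  var beta `<=` var (binary_app c2 alpha beta).
Proof.
(* [ord_max] in ['I_2] is index 1, the position of [beta]. *)
move=> v betav; exists (cast_ord (esym c2) ord_max) => //.
by rewrite ffunE cast_ordKV.
Qed.

Theorem theorem4p1 (L : language) (V : Type)
  (V_countably_infinite : [set: V] #= [set: nat])
  (entails : set (formula L V) -> formula L V -> Prop)
  (entails_logic : is_logic entails)
  (imp : connective L) (imp_binary : arity imp = 2) :
  deduction_theorem entails imp_binary ->
  deduction_theorem (left_companion entails) imp_binary.
Proof.
move=> ded Sigma alpha beta [Gamma [sGamma varGamma Gamma_beta]].
exists (Gamma `&` Sigma); split; first exact: subIsetr.
- move=> v [gamma [Ggamma _] gammav]; apply: var_binary_app_right.
  by apply: varGamma; exists gamma.
(* [alpha] may be absent from [Gamma], so [Gamma] is only included in its trace on [Sigma] with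
   [alpha] added; monotonicity bridges the gap. *)
- apply: ded; apply: entails_monotone Gamma_beta => // gamma Ggamma.
  by case: (sGamma _ Ggamma) => [Sgamma | ->]; [left | right].
Qed.
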